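(* Let $k\ge2$ and let $\mathcal{H}$ be a connected $k$-graph with at least one edge. Then the cyclic index of $\mu(\mathcal{H},x)$ is equal to $k$.
   Context: A $k$-graph $\mathcal{H}$ has a finite vertex set and an edge set of $k$-element vertex subsets; connected means any two vertices are joined by a path (alternating sequence of distinct vertices and distinct edges with consecutive vertices contained in the edge between them). $\mu(\mathcal{H},x)=\sum_{r\ge0}(-1)^rp(\mathcal{H},r)x^{|V(\mathcal{H})|-kr}$, where $p(\mathcal{H},r)$ counts sets of $r$ pairwise disjoint edges ($p(\mathcal{H},0)=1$). A real polynomial $f$ is $\ell$-symmetric if $f(x)=x^tg(x^\ell)$ for some integer $t\ge0$ and real polynomial $g$; the cyclic index of $f$ is the maximum $\ell$ for which $f$ is $\ell$-symmetric. *)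

(* Defs.v *)
From HB Require Import structures.
From mathcomp Require Import all_boot all_order all_algebra.
From mathcomp Require Import reals.

Set Implicit Arguments.
Unset Strict Implicit.
Unset Printing Implicit Defensive.

Import GRing.Theory.
Local Open Scope ring_scope.

Record kgraph (k : nat) (V : finType) := KGraph {
  edges : {set {set V}};
  card_edge : forall e, e \in edges -> #|e| = k
}.

Section KGraphs.

Variables (k : nat) (V : finType).
Implicit Type H : kgraph k V.

(* The alternating sequence x, e1, v1, ..., em, vm is represented by its
   first vertex x and the list [:: (e1, v1); ...; (em, vm)]. *)
Fixpoint walk H (x : V) (s : seq ({set V} * V)) : bool :=
  if s is (e, y) :: s' then
    [&& e \in edges H, x \in e, y \in e & walk H y s']
  else true.

Definition hpath H (x : V) (s : seq ({set V} * V)) (y : V) : bool :=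
  [&& walk H x s, last x (unzip2 s) == y,
      uniq (x :: unzip2 s) & uniq (unzip1 s)].

Definition connected H : Prop :=
  forall x y : V, exists s, hpath H x s y.

Definition matching_number H (r : nat) : nat :=
  #|[set M : {set {set V}} | [&& M \subset edges H, #|M| == r & trivIset M]]|.

(* Matchings have at most #|edges H| edges, so the sum over all r is finite.
   The truncated subtraction is harmless: r pairwise disjoint edges cover k * r
   vertices, so matching_number H r is 0 whenever #|V| < k * r. *)
Definition matching_poly (R : realType) H : {poly R} :=
  \sum_(r < #|edges H|.+1)
    ((-1) ^+ r * (matching_number H r)%:R) *: 'X^(#|V| - k * r).

End KGraphs.

Definition symmetric_poly (R : realType) (l : nat) (f : {poly R}) : Prop :=
  exists (t : nat) (g : {poly R}), f = 'X^t * (g \Po 'X^l).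

(* A relation rather than a function: a monomial is l-symmetric for all l, and
   so has no cyclic index. *)
Definition is_cyclic_index (R : realType) (f : {poly R}) (l : nat) : Prop :=
  symmetric_poly l f /\ forall m : nat, symmetric_poly m f -> (m <= l)%N.

(* Main.v *)
Require Import Defs.
From mathcomp Require Import all_boot all_order all_algebra.
From mathcomp Require Import reals.

(** The exponents [#|V| - k * r] are all congruent modulo [k], so the matching
    polynomial is [k]-symmetric.  Conversely, the exponents of an [m]-symmetric
    polynomial are all congruent modulo [m]; since [x^#|V|] and [x^(#|V| - k)]
    have the nonzero coefficients [1] and [- #|edges H|], [m] divides [k]. *)

Import GRing.Theory Num.Theory.

Section MatchingNumber.

Variables (k : nat) (V : finType) (H : kgraph k V).

Lemma matching_number0 : matching_number H 0 = 1.
Proof.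
rewrite /matching_number -(cards1 (set0 : {set {set V}})).
apply: eq_card => M; rewrite !inE cards_eq0.
case: eqP => [->|_]; last by rewrite andbF.
by rewrite sub0set; apply/trivIsetP => A B; rewrite inE.
Qed.

Lemma matching_number1_gt0 : edges H != set0 -> 0 < matching_number H 1.
Proof.
case/set0Pn => e eH; rewrite card_gt0; apply/set0Pn; exists [set e].
rewrite inE sub1set eH cards1 eqxx /=.
by apply/trivIsetP => A B /set1P-> /set1P->; rewrite eqxx.
Qed.

Lemma matching_number_eq0 r : #|V| < k * r -> matching_number H r = 0.
Proof.
move=> ltVkr; apply/eqP; rewrite cards_eq0; apply/set0Pn => -[M].
rewrite inE => /and3P[MH /eqP cardM /eqP trivM].
suff: k * r <= #|V| by rewrite leqNgt ltVkr.
rewrite -cardM mulnC -sum_nat_const.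
rewrite -(eq_bigr _ (fun e eM => card_edge (subsetP MH e eM))) trivM.
exact: max_card.
Qed.

Lemma card_vertices_ge : edges H != set0 -> k <= #|V|.
Proof. by case/set0Pn => e /card_edge <-; exact: max_card. Qed.

End MatchingNumber.

Local Open Scope ring_scope.

(** For [0 < k] the untruncated exponents [#|V| - k * s] are pairwise distinct, so a single summand
    contributes to this coefficient. *)
Lemma coef_matching_poly (R : realType) (k : nat) (V : finType)
    (H : kgraph k V) (r : nat) :
  (0 < k)%N -> (k * r <= #|V|)%N -> (r <= #|edges H|)%N ->
  (matching_poly R H)`_(#|V| - k * r) = (-1) ^+ r * (matching_number H r)%:R.
Proof.
move=> k_gt0 krV rE; rewrite /matching_poly coef_sum.
rewrite (bigD1 (Ordinal (rE : (r < #|edges H|.+1)%N))) //=.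
rewrite coefZ coefXn eqxx mulr1 big1 ?addr0 // => s neq_sr.
(* A truncated exponent is 0 and may collide with [#|V| - k * r], but its coefficient vanishes. *)
have [ksV|/matching_number_eq0->] := leqP (k * s) #|V|; last first.
  by rewrite mulr0 scale0r coef0.
rewrite coefZ coefXn (_ : (_ == _) = false) ?mulr0 //.
apply: contra_neqF neq_sr => /eqP eq_sub; apply/val_inj/eqP => /=.
by rewrite -(eqn_pmul2l k_gt0) -(eqn_sub2lE ksV krV) eq_sub.
Qed.

Lemma matching_poly_symmetric (R : realType) (k : nat) (V : finType)
    (H : kgraph k V) : (0 < k)%N -> symmetric_poly k (matching_poly R H).
Proof.
(* Euclidean division of [#|V|] by [k] gives [#|V| - k * r = #|V| %% k + k * (#|V| %/ k - r)]. *)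
move=> k_gt0; exists (#|V| %% k)%N.
exists (\sum_(r < #|edges H|.+1)
  ((-1) ^+ r * (matching_number H r)%:R) *: 'X^(#|V| %/ k - r)).
rewrite raddf_sum mulr_sumr; apply: eq_bigr => r _ /=.
have [krV|/matching_number_eq0->] := leqP (k * r) #|V|; last first.
  by rewrite mulr0 !scale0r comp_poly0 mulr0.
rewrite comp_polyZ -scalerAr comp_Xn_poly -exprM -exprD; congr (_ *: 'X^_).
have rVk : (r <= #|V| %/ k)%N by rewrite leq_divRL // mulnC.
rewrite mulnBr addnBA ?leq_mul2l ?rVk ?orbT //.
by congr (_ - _)%N; rewrite addnC mulnC -divn_eq.
Qed.

(** In ['X^t * (g \Po 'X^m)] a nonzero coefficient has index at least [t] and congruent to [t]
    modulo [m]. *)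
Lemma symmetric_poly_dvd_sub (R : realType) (m : nat) (f : {poly R})
    (i d : nat) : (0 < m)%N -> symmetric_poly m f ->
  f`_(i + d) != 0 -> f`_i != 0 -> (m %| d)%N.
Proof.
move=> m_gt0 [t [g ->]]; rewrite !coefXnM.
have [|t_le_i] := ltnP i t; first by rewrite eqxx.
rewrite ltnNge (leq_trans t_le_i (leq_addr _ _)) /= !coef_comp_poly_Xn //.
have [m_id|_] := ifP; last by rewrite eqxx.
have [m_i _ _|_] := ifP; last by rewrite eqxx.
by rewrite -(dvdn_addr _ m_i) addnBAC.
Qed.

Local Close Scope ring_scope.

Theorem theorem4p3 (R : realType) (k : nat) (V : finType) (H : kgraph k V) :
  2 <= k -> connected H -> edges H != set0 ->
  is_cyclic_index (matching_poly R H) k.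
Proof.
move=> k_ge2 _ H_edge; have k_gt0 : 0 < k by exact: ltnW.
split=> [|m sym_m]; first exact: matching_poly_symmetric.
(* The case [m = 0], where [g \Po 'X^0] is constant, satisfies the bound trivially. *)
case: (posnP m) => [->//|m_gt0].
have kV := card_vertices_ge _ _ _ H_edge.
apply: dvdn_leq => //.
(* The indices [#|V|] and [#|V| - k] belong to [r = 0] and [r = 1], so [d] is [k]. *)
apply: (symmetric_poly_dvd_sub _ _ _ (#|V| - k) _ m_gt0 sym_m).
- rewrite subnK // -[#|V|]subn0 -(muln0 k) coef_matching_poly ?muln0 //.
  by rewrite matching_number0 mul1r oner_neq0.
- rewrite -[X in #|V| - X]muln1 coef_matching_poly ?muln1 ?card_gt0 //.
  (* A positive number of edges stays nonzero in [R], which has characteristic 0. *)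
  by rewrite mulf_eq0 signr_eq0 pnatr_eq0 -lt0n matching_number1_gt0.
Qed.
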